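(* Let $f$ be a symplectic twist map of $\mathbb A$. Let $u_1,u_2$ be two weak K.A.M. solutions for the cohomology classes $c_1$ and $c_2$ respectively, such that $\rho(c_1)<\rho(c_2)$. Then: - $c_1<c_2$; - for any $t\in\mathbb T$, if $(t,p_1)\in\partial u_1(t)$ and $(t,p_2)\in\partial u_2(t)$ then $c_1+p_1<c_2+p_2$; - in particular, at every point $t$ of differentiability of $u_1$ and $u_2$, $c_1+u_1'(t)<c_2+u_2'(t)$.
   Context: $\mathbb T=\mathbb R/\mathbb Z$, $\mathbb A=\mathbb T\times\mathbb R$ with coordinates $(\theta,r)$. Symplectic twist map: a $C^1$ diffeomorphism $f:\mathbb A\to\mathbb A$ that is isotopic to the identity; exact symplectic, i.e. if $f(\theta,r)=(\Theta,R)$ then the 1-form $R\,d\Theta-r\,d\theta$ is exact; and has the twist property: for any lift $F=(F_1,F_2):\mathbb R^2\to\mathbb R^2$ of $f$ and any $\tilde\theta\in\mathbb R$, the map $r\mapsto F_1(\tilde\theta,r)$ is an increasing $C^1$ diffeomorphism from $\mathbb R$ onto $\mathbb R$. Generating function: fix a lift $F$ of $f$. A $C^2$ function $S:\mathbb R^2\to\mathbb R$ is a generating function of $F$ if $S(\theta+1,\Theta+1)=S(\theta,\Theta)$; $S(\theta,\Theta)/|\Theta-\theta|\to+\infty$ as $|\Theta-\theta|\to\infty$; for all $\theta_0,\Theta_0$ the maps $\theta\mapsto\frac{\partial S}{\partial\Theta}(\theta,\Theta_0)$ and $\Theta\mapsto\frac{\partial S}{\partial\theta}(\theta_0,\Theta)$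 are decreasing diffeomorphisms of $\mathbb R$; and $F(\theta,r)=(\Theta,R)\Leftrightarrow r=-\frac{\partial S}{\partial\theta}(\theta,\Theta)$ and $R=\frac{\partial S}{\partial\Theta}(\theta,\Theta)$. Fix such an $S$. Weak K.A.M. solutions: for $c\in\mathbb R$ there is a unique $\alpha(c)\in\mathbb R$ for which there exists $u\in C^0(\mathbb T,\mathbb R)$ whose lift $\tilde u:\mathbb R\to\mathbb R$ satisfies, for all $\theta\in\mathbb R$, $\tilde u(\theta)=\inf_{\theta'\in\mathbb R}\big(\tilde u(\theta')+S(\theta',\theta)+c(\theta'-\theta)+\alpha(c)\big)$. Any such $u$ is a weak K.A.M. solution for the cohomology class $c$. Weak K.A.M. solutions are semi-concave, hence Lipschitz. Rotation number: $\alpha$ is convex and $C^1$; the rotation number associated to $c$ is $\rho(c)=\alpha'(c)$. (For every weak K.A.M. solution $u$ for the class $c$, it is the common rotation number of the $F$-orbits lifting orbits of the invariant compact set $\bigcap_{n\in\mathbb N}f^{-n}(\mathcal G(c+u'))$.) $\mathcal G(c+u')=\{(\theta,c+u'(\theta)):\ u \text{ differentiable at }\theta\}$. For a Lipschitz $g:\mathbb T\to\mathbb R$, $\partial g(x)=\mathrm{co}\{(x,p)\in\mathbb T\times\mathbb R:(x,p)\in\overline{\mathcal G(g')}\}$, where co is the convex hull in the fiber direction. *)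

(* Defs.v *)
From HB Require Import structures.
From mathcomp Require Import all_boot all_order all_algebra generic_quotient.
From mathcomp Require Import all_classical all_reals all_analysis.

Set Implicit Arguments.
Unset Strict Implicit.
Unset Printing Implicit Defensive.

Import Order.TTheory GRing.Theory Num.Theory.
Import numFieldNormedType.Exports.

Local Open Scope classical_set_scope.
Local Open Scope ring_scope.
Local Open Scope quotient_scope.

Section Circle.
Context (R : realType).

Definition eq_mod1 : rel R := fun x y => x - y \is a Num.int.

Lemma eq_mod1_refl : reflexive eq_mod1.
Proof. by move=> x; rewrite /eq_mod1 subrr rpred0. Qed.

Lemma eq_mod1_sym : symmetric eq_mod1.
Proof. by move=> x y; rewrite /eq_mod1 -opprB rpredN. Qed.

Lemma eq_mod1_trans : transitive eq_mod1.
Proof.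
by move=> y x z xy yz; rewrite /eq_mod1 -(subrKA y) rpredD.
Qed.

Definition eq_mod1_equiv := EquivRel _ eq_mod1_refl eq_mod1_sym eq_mod1_trans.

Definition circle := {eq_quot eq_mod1_equiv}.

HB.instance Definition _ := Topological.copy circle (quotient_topology circle).
HB.instance Definition _ := Quotient.on circle.

Definition to_circle (x : R) : circle := \pi_circle x.

End Circle.

Notation annulus R := (circle R * R)%type.

Definition to_annulus (R : realType) (x : R * R) : annulus R :=
  (to_circle x.1, x.2).

Section Smooth.
Context (R : realType).

(* V is meant to be finite dimensional: continuity of every directional
   derivative is then continuity of the differential. *)
Definition C1 (V W : normedModType R) (g : V -> W) : Prop :=
  (forall x, differentiable g x) /\ (forall v, continuous ('D_v g)).

Definition C2 (V W : normedModType R) (g : V -> W) : Prop :=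
  C1 g /\ (forall v, C1 ('D_v g)).

Definition C1_diffeo (V W : normedModType R) (g : V -> W) : Prop :=
  C1 g /\ exists h : W -> V, [/\ C1 h, cancel g h & cancel h g].

Definition increasing_diffeo (g : R -> R) : Prop :=
  C1_diffeo g /\ {homo g : x y / x < y}.

Definition decreasing_diffeo (g : R -> R) : Prop :=
  C1_diffeo g /\ {homo g : x y /~ x < y}.

End Smooth.

Section TwistMaps.
Context (R : realType).
Local Notation A := (annulus R).

Definition is_lift (f : A -> A) (F : R * R -> R * R) : Prop :=
  continuous F /\ forall x, to_annulus (F x) = f (to_annulus x).

(* [to_annulus] is the universal covering of the annulus and a local
   diffeomorphism, so a map of the annulus is C^1 iff it has a C^1 lift. *)
Definition annulus_C1 (f : A -> A) : Prop :=
  exists2 F, is_lift f F & C1 F.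

Definition annulus_diffeo (f : A -> A) : Prop :=
  annulus_C1 f /\ exists g, [/\ annulus_C1 g, cancel f g & cancel g f].

Definition homeomorphism (X Y : topologicalType) (g : X -> Y) : Prop :=
  continuous g /\ exists h, [/\ continuous h, cancel g h & cancel h g].

Definition isotopic_to_id (f : A -> A) : Prop :=
  exists h : R -> A -> A,
    [/\ {within `[0, 1]%classic `*` [set: A],
          continuous (fun z : R * A => h z.1 z.2)},
        (forall t, 0 <= t <= 1 -> homeomorphism (h t)),
        h 0 = id & h 1 = f].

(* G is a primitive of R dTheta - r dtheta; the form is computed upstairs,
   where dTheta does not depend on the lift of f. *)
Definition exact_symplectic (f : A -> A) : Prop :=
  exists G : A -> R, C1 (G \o @to_annulus R) /\
    forall F, is_lift f F -> forall x v : R * R,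
      'D_v (G \o @to_annulus R) x = (F x).2 * ('D_v F x).1 - x.2 * v.1.

Definition twist (f : A -> A) : Prop :=
  forall F, is_lift f F ->
    forall theta, increasing_diffeo (fun r => (F (theta, r)).1).

Definition symplectic_twist_map (f : A -> A) : Prop :=
  [/\ annulus_diffeo f, isotopic_to_id f, exact_symplectic f & twist f].

(* [d1 S] and [d2 S] are dS/dtheta and dS/dTheta. *)
Definition d1 (S : R * R -> R) : R * R -> R := 'D_((1, 0) : R * R) S.
Definition d2 (S : R * R -> R) : R * R -> R := 'D_((0, 1) : R * R) S.

Definition superlinear (S : R * R -> R) : Prop :=
  forall M : R, exists K : R, forall theta Theta : R,
    K <= `|Theta - theta| -> M <= S (theta, Theta) / `|Theta - theta|.

Definition generating_function (F : R * R -> R * R) (S : R * R -> R) : Prop :=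
  [/\ C2 S,
      (forall theta Theta, S (theta + 1, Theta + 1) = S (theta, Theta)),
      superlinear S,
      (forall Theta0, decreasing_diffeo (fun theta => d2 S (theta, Theta0))) /\
      (forall theta0, decreasing_diffeo (fun Theta => d1 S (theta0, Theta))) &
      forall theta r Theta p, F (theta, r) = (Theta, p) <->
        r = - d1 S (theta, Theta) /\ p = d2 S (theta, Theta)].

End TwistMaps.

Section WeakKAM.
Context (R : realType).

Definition lift_fun (u : circle R -> R) : R -> R := u \o @to_circle R.

(* The infimum is taken in the extended reals, so that the equation contains
   the fact that it is finite. *)
Definition weak_KAM_with (S : R * R -> R) (c a : R) (u : circle R -> R) : Prop :=
  continuous u /\
  forall theta : R, (lift_fun u theta)%:E =
    ereal_inf (range (fun theta' : R =>
      (lift_fun u theta' + S (theta', theta) + c * (theta' - theta) + a)%:E)).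

(* The relational description of c |-> alpha(c): existence of a solution for
   alpha(c), and uniqueness of alpha(c). *)
Definition is_alpha (S : R * R -> R) (alpha : R -> R) : Prop :=
  forall c a, a = alpha c <-> exists u, weak_KAM_with S c a u.

Definition weak_KAM (S : R * R -> R) (alpha : R -> R) (c : R)
  (u : circle R -> R) : Prop := weak_KAM_with S c (alpha c) u.

Definition is_rotation_number (alpha rho : R -> R) : Prop :=
  forall c : R, is_derive c 1 alpha (rho c).

Definition has_deriv (g : circle R -> R) (t : circle R) (p : R) : Prop :=
  exists2 x : R, to_circle x = t & is_derive x 1 (lift_fun g) p.

Definition graph_deriv (g : circle R -> R) : set (annulus R) :=
  [set z | has_deriv g z.1 z.2].

Definition fiber_hull (E : set (annulus R)) (t : circle R) : set (annulus R) :=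
  [set z | z.1 = t /\
    smallest (@convex_set R R^o) [set p | E (t, p)] z.2].

(* The part of $\partial g$ above t, for $\partial g$ the fiberwise convex hull
   of the closure of the graph of g'; not a subdifferential at t alone. *)
Definition gen_subdiff (g : circle R -> R) (t : circle R) : set (annulus R) :=
  fiber_hull (closure (graph_deriv g)) t.

End WeakKAM.

(* Main.v *)
Require Import Defs.
From HB Require Import structures.
From mathcomp Require Import all_boot all_order all_algebra generic_quotient.
From mathcomp Require Import all_classical all_reals all_analysis.
From mathcomp Require Import ring lra.
Import Order.TTheory GRing.Theory Num.Theory.
Import numFieldNormedType.Exports.
Local Open Scope classical_set_scope.
Local Open Scope ring_scope.

Set Implicit Arguments.
Unset Strict Implicit.
Unset Printing Implicit Defensive.

(* A limit (t, p) of points of the graph of u' comes from a minimizer y of the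
   weak K.A.M. equation at t, with c + p = (d2 S)(y, t). As (d2 S)(., t) is
   decreasing, the claim is that every minimizer y1 for u1 at t lies to the right
   of every minimizer y2 for u2. Continue both backwards into calibrated orbits.
   If y1 <= y2, Aubry's non-crossing lemma keeps the first orbit to the left of
   the second one forever. Evaluating, along a calibrated orbit of class c, the
   weak K.A.M. inequality of another class c' gives, up to a bounded error,
   n (alpha c' - alpha c) >= (c' - c) (x_0 - x_n); this makes alpha convex, and
   applied with c' = c1 + h and with c' = c2 - h it turns the comparison of the
   orbits into rho(c2) <= rho(c1), a contradiction. *)

(** * The circle as a quotient, and lifts of functions to the line *)

Section Circle.
Context (R : realType).
Implicit Types (u : circle R -> R) (x y : R).

Lemma to_circle_eqP x y : to_circle x = to_circle y <-> x - y \is a Num.int.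
Proof.
by split => [/eqmodP|xy]; last apply/eqmodP.
Qed.

Lemma to_circle_surj (t : circle R) : exists x, to_circle x = t.
Proof. by exists (repr t); rewrite /to_circle reprK. Qed.

Lemma to_circle_continuous : continuous (@to_circle R).
Proof. exact: pi_continuous. Qed.

Lemma lift_fun_continuous u : continuous u -> continuous (lift_fun u).
Proof.
by move=> uc x; apply: continuous_comp; [exact: to_circle_continuous|exact: uc].
Qed.

Lemma lift_fun_periodic u x (k : R) :
  k \is a Num.int -> lift_fun u (x + k) = lift_fun u x.
Proof.
by move=> kint; congr u; apply/to_circle_eqP; rewrite addrAC subrr add0r.
Qed.

Lemma lift_fun_bounded u : continuous u ->
  exists B : R, forall x, `|lift_fun u x| <= B.
Proof.
move=> /lift_fun_continuous uc.
have uc' : continuous (fun x => `|lift_fun u x|).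
  by move=> x; apply: cvg_norm; exact: uc.
have [m _ mP] := @EVT_max R (fun x => `|lift_fun u x|) 0 1 ler01
  (continuous_subspaceT uc').
exists `|lift_fun u m| => x.
have := mP (x - (Num.floor x)%:~R).
rewrite lift_fun_periodic ?rpredN ?intr_int//; apply.
have /andP[? ?] := mem_rg1_floor x.
rewrite in_itv/=; lra.
Qed.

(** The preimage of the image of [A] is the union of the integer translates of [A]. *)
Lemma to_circle_open (A : set R) : open A -> open (@to_circle R @` A).
Proof.
move=> oA.
rewrite /open/= /quotient_open.
rewrite (_ : _ @^-1` _ =
    \bigcup_(k in [set k : R | k \is a Num.int]) ((+%R^~ k) @^-1` A)).
  apply: bigcup_open => k _; apply: open_comp => // x _.
  by apply: cvgD; [exact: cvg_id|exact: cvg_cst].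
apply/seteqP; split => x/=.
  move=> [y Ay /to_circle_eqP yx]; exists (y - x) => //=.
  by rewrite addrC subrK.
move=> [k/= kint Axk]; exists (x + k) => //.
by apply/to_circle_eqP; rewrite addrAC subrr add0r.
Qed.

End Circle.

(** * Derivatives in one variable *)

Section FirstOrder.
Context (R : realType).
Implicit Types (f g : R -> R) (x y r s : R).

Lemma is_derive_first_order f x r : is_derive x 1 f r ->
  forall e, 0 < e -> exists2 d, 0 < d &
    forall h, `|h| < d -> `|f (x + h) - f x - h * r| <= e * `|h|.
Proof.
move=> [df <-] e e0.
have /cvgrPdist_le/(_ _ e0) :
  (fun h : R => h^-1 *: ((f \o shift x) (h *: 1) - f x)) @ 0^' --> 'D_1 f x := df.
rewrite near_withinE => /nbhs_ballP[d/= d0 dP]; exists d => // h hd.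
have [->|h0] := eqVneq h 0.
  by rewrite addr0 subrr mul0r subr0 normr0 mulr0.
have /= := dP h.
rewrite /ball/= sub0r normrN => /(_ hd h0).
rewrite (_ : h *: 1 = h) ?[h *: _]mulr1// => H.
rewrite -ler_pdivrMr ?normr_gt0// -normf_div (le_trans _ H)//.
rewrite distrC le_eqVlt; apply/orP; left; apply/eqP; congr `|_|.
rewrite (addrC h) [_ *: _]mulrC.
by field.
Qed.

(** The sum of the two increments is [h * (r - s)] up to o(h). The increments go in opposite
    directions to suit the later perturbations c1 + h and c2 - h. *)
Lemma is_derive_le f g x y r s : is_derive x 1 f r -> is_derive y 1 g s ->
  (forall h, 0 < h -> 0 <= (f (x + h) - f x) + (g (y - h) - g y)) -> s <= r.
Proof.
move=> fr gs fg; apply/ler_addgt0Pr => e e0.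
have e2 : 0 < e / 2 by rewrite divr_gt0.
have [d d0 dP] := is_derive_first_order fr e2.
have [d' d'0 dP'] := is_derive_first_order gs e2.
pose h := Num.min d d' / 2.
have h0 : 0 < h by rewrite divr_gt0// lt_min d0.
have hd : h < d /\ h < d'.
  have : Num.min d d' <= d /\ Num.min d d' <= d' by rewrite !ge_min !lexx orbT.
  by rewrite /h in h0 *; lra.
have := dP h; have := dP' (- h); have := fg h h0.
rewrite normrN gtr0_norm//.
move=> H /(_ hd.2) + /(_ hd.1).
rewrite !ler_norml => /andP[_ H1] /andP[_ H2].
rewrite -(ler_pM2l h0); lra.
Qed.

Lemma is_derive_global_min f x r :
  is_derive x 1 f r -> (forall z, f x <= f z) -> r = 0.
Proof.
move=> fr fmin; apply/eqP; rewrite eq_le; apply/andP; split.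
  apply: (@is_derive_le (cst 0) f x x) => h _.
  by rewrite /= subrr add0r subr_ge0.
apply: (@is_derive_le f (cst 0) x x) => h _.
by rewrite /= subrr addr0 subr_ge0.
Qed.

Lemma is_derive_mull (a x : R) : is_derive x 1 ( *%R a) a.
Proof. by apply: is_derive_eq; rewrite -[_ *: 1]/(_ * 1) mulr1. Qed.

End FirstOrder.

(** * Generating functions and the twist condition *)

Section GeneratingFunction.
Context (R : realType) (F : R * R -> R * R) (S : R * R -> R).
Hypothesis S_gen : generating_function F S.
Implicit Types a b p q x y z : R.

Lemma generating_continuous : continuous S.
Proof.
by have [[[Sd _] _] _ _ _ _] := S_gen => z; exact: differentiable_continuous.
Qed.

Lemma d2_continuous : continuous (d2 S).
Proof. by have [[[_ dSc] _] _ _ _ _] := S_gen; exact: dSc. Qed.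

Lemma is_derive_d1 y x : is_derive y 1 (fun z => S (z, x)) (d1 S (y, x)).
Proof.
have [[[Sd _] _] _ _ _ _] := S_gen.
have : derivable S (y, x) ((1, 0) : R * R) by exact/diff_derivable/Sd.
have E : (fun h : R =>
    h^-1 *: ((S \o shift (y, x)) (h *: ((1, 0) : R * R)) - S (y, x))) =
  (fun h : R => h^-1 *: (((fun z => S (z, x)) \o shift y) (h *: 1) - S (y, x))).
  apply/funext => h /=; congr (_ *: (S (_, _) - _)).
  by rewrite -[X in X + _]/(h * 0) mulr0 add0r.
by rewrite /derivable E => Sd'; split => //; rewrite /d1 /derive E.
Qed.

Lemma is_derive_d2 y x : is_derive x 1 (fun z => S (y, z)) (d2 S (y, x)).
Proof.
have [[[Sd _] _] _ _ _ _] := S_gen.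
have : derivable S (y, x) ((0, 1) : R * R) by exact/diff_derivable/Sd.
have E : (fun h : R =>
    h^-1 *: ((S \o shift (y, x)) (h *: ((0, 1) : R * R)) - S (y, x))) =
  (fun h : R => h^-1 *: (((fun z => S (y, z)) \o shift x) (h *: 1) - S (y, x))).
  apply/funext => h /=; congr (_ *: (S (_, _) - _)).
  by rewrite -[X in X + _]/(h * 0) mulr0 add0r.
by rewrite /derivable E => Sd'; split => //; rewrite /d2 /derive E.
Qed.

Lemma d1_decreasing x : {homo (fun y => d1 S (x, y)) : a b /~ a < b}.
Proof. by have [_ _ _ [_ H] _] := S_gen; have [_] := H x. Qed.

Lemma d2_decreasing x : {homo (fun y => d2 S (y, x)) : a b /~ a < b}.
Proof. by have [_ _ _ [H _] _] := S_gen; have [_] := H x. Qed.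

Lemma d2_surjective x p : exists y, d2 S (y, x) = p.
Proof.
have [_ _ _ [H _] _] := S_gen.
by have [[_ [h [_ _ hK]]] _] := H x; exists (h p); exact: hK.
Qed.

Lemma d1_inj x : injective (fun y => d1 S (x, y)).
Proof.
move=> a b /= ab; case: (ltgtP a b) => // H; have := d1_decreasing x H; lra.
Qed.

Lemma d2_inj x : injective (fun y => d2 S (y, x)).
Proof.
move=> a b /= ab; case: (ltgtP a b) => // H; have := d2_decreasing x H; lra.
Qed.

(** By the twist, S(b, .) - S(a, .) has negative derivative; the mean value theorem concludes. *)
Lemma twist_exchange a b p q : a < b -> p < q ->
  S (b, q) + S (a, p) < S (b, p) + S (a, q).
Proof.
move=> ab pq.
have D x : is_derive x 1 ((fun z => S (b, z)) - (fun z => S (a, z)))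
    (d2 S (b, x) - d2 S (a, x)).
  exact: is_deriveB (is_derive_d2 b x) (is_derive_d2 a x).
have [|s _] := @MVT _ ((fun z => S (b, z)) - (fun z => S (a, z))) _ _ _ pq
  (fun x _ => D x).
  apply: derivable_within_continuous => x _; by have [] := D x.
rewrite /= => E.
have : (d2 S (b, s) - d2 S (a, s)) * (q - p) < 0.
  by rewrite nmulr_rlt0 ?subr_gt0// subr_lt0; exact: d2_decreasing.
rewrite -E !fctE; lra.
Qed.

Lemma euler_lagrange z x y :
  (forall x', S (z, x) + S (x, y) <= S (z, x') + S (x', y)) ->
  d2 S (z, x) + d1 S (x, y) = 0.
Proof.
have := is_deriveD (is_derive_d2 z x) (is_derive_d1 x y).
exact: is_derive_global_min.
Qed.

End GeneratingFunction.

(** * Weak K.A.M. solutions and calibrated orbits *)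

Section Calibration.
Context (R : realType) (S : R * R -> R).
Implicit Types (a c x y z : R) (U : R -> R) (xs ys : nat -> R).

Definition dominated a U := forall y x, U x <= U y + S (y, x) + a.

Definition calibrated a U y x := U x = U y + S (y, x) + a.

(** Time runs backwards: [xs n.+1] is the predecessor of [xs n]. *)
Definition calibrated_orbit a U xs := forall n, calibrated a U (xs n.+1) (xs n).

(* [U x] stands for [u x + c * x], which removes the cohomology class from the
   weak K.A.M. equation. *)
Definition KAM_primitive c a U :=
  [/\ continuous U, exists B : R, forall x, `|U x - c * x| <= B,
      dominated a U & forall x, exists y, calibrated a U y x].

(** The point is that the infimum is attained: superlinearity of [S] confines the minimization to a
    compact interval. *)
Lemma weak_KAM_primitive F c a u : generating_function F S ->
  weak_KAM_with S c a u -> KAM_primitive c a (fun x => lift_fun u x + c * x).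
Proof.
move=> S_gen [uc uinf].
have [B uB] := lift_fun_bounded uc.
have vc := lift_fun_continuous uc.
have dom : dominated a (fun x => lift_fun u x + c * x).
  move=> y x; suff : lift_fun u x <= lift_fun u y + S (y, x) + c * (y - x) + a.
    by lra.
  by rewrite -lee_fin uinf; apply: ereal_inf_lbound; exists y.
split => //.
- move=> x; apply: cvgD; first exact: vc.
  by apply: cvgM; [exact: cvg_cst|exact: cvg_id].
- by exists B => x; rewrite addrK.
move=> x.
pose phi y := lift_fun u y + S (y, x) + c * (y - x) + a.
have phic : continuous phi.
  move=> y; apply: cvgD; last exact: cvg_cst.
  apply: cvgD.
    apply: cvgD; first exact: vc.
    have [H _] := is_derive_d1 S_gen y x.
    exact/differentiable_continuous/derivable1_diffP.
  apply: cvgM; first exact: cvg_cst.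
  by apply: cvgB; [exact: cvg_id|exact: cvg_cst].
have [_ _ Ssup _ _] := S_gen.
(* Slope |c| + 1 absorbs the linear term in c and leaves |x - y|, which beyond [L] outweighs [phi x]
   and the bounded terms. *)
have [K KP] := Ssup (`|c| + 1).
pose L := Num.max K 1 + `|phi x| + B + `|a|.
have L1 : K <= L /\ 1 <= L.
  have : K <= Num.max K 1 /\ 1 <= Num.max K 1 by rewrite !le_max !lexx orbT.
  have := normr_ge0 (phi x); have := normr_ge0 a.
  have := le_trans (normr_ge0 _) (uB x); rewrite /L; lra.
have far y : L <= `|x - y| -> phi x <= phi y.
  move=> Ly; have := KP y x (le_trans L1.1 Ly).
  have d0 : 0 < `|x - y| by lra.
  rewrite ler_pdivlMr// => HS.
  have : - (`|c| * `|x - y|) <= c * (y - x).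
    by rewrite lerNl distrC -normrM -normrN ler_norm.
  have : - B <= lift_fun u y by have := uB y; rewrite ler_norml => /andP[].
  have : phi x <= `|phi x| := ler_norm _.
  have : - a <= `|a| by rewrite -normrN; exact: ler_norm.
  have : 1 <= Num.max K 1 by rewrite le_max lexx orbT.
  rewrite /L in Ly.
  move: (phi x) Ly => v Ly; rewrite /phi; lra.
have [||m _ mP] := @EVT_min _ phi (x - L) (x + L).
- by lra.
- exact: continuous_subspaceT.
have min y : phi m <= phi y.
  have [/ltW Ly|Ly] := ltP L `|x - y|.
    apply: le_trans (far _ Ly); apply: mP; rewrite in_itv/=; lra.
  apply: mP; rewrite in_itv/=; move: Ly; rewrite ler_norml; lra.
exists m; suff : lift_fun u x = phi m by rewrite /calibrated /phi; lra.
apply/eqP; rewrite eq_le -!lee_fin uinf; apply/andP; split.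
  by apply: ereal_inf_lbound; exists m.
by apply: le_ereal_inf_tmp => _ [y _ <-]; rewrite lee_fin; exact: min.
Qed.

Lemma calibrated_orbit_exists a U x y :
  (forall x, exists y, calibrated a U y x) ->
  calibrated a U y x ->
  exists xs, [/\ calibrated_orbit a U xs, xs 0%N = x & xs 1%N = y].
Proof.
move=> /choice[f fP] yx.
exists (fun n => if n is n'.+1 then iter n' f y else x).
by split => // -[|n]//=.
Qed.

(** Subtracting calibration from domination cancels [S] at each step, and the remaining differences
    telescope. *)
Lemma dominated_calibrated_orbit a1 a2 U1 U2 xs n :
  dominated a2 U2 -> calibrated_orbit a1 U1 xs ->
  (U2 (xs 0%N) - U1 (xs 0%N)) - (U2 (xs n) - U1 (xs n)) <= n%:R * (a2 - a1).
Proof.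
move=> dom cal; elim: n => [|n IH]; first by rewrite subrr mul0r.
have := dom (xs n.+1) (xs n); have := cal n; rewrite /calibrated.
rewrite -natr1 mulrDl mul1r; lra.
Qed.

End Calibration.

(** * Non-crossing of calibrated orbits *)

Section Crossing.
Context (R : realType) (F : R * R -> R * R) (S : R * R -> R).
Hypothesis S_gen : generating_function F S.
Implicit Types (a c x y z : R) (U : R -> R) (xs ys : nat -> R).

(** Two applications of domination through x', with equality at x, show that x minimizes the
    two-step action. *)
Lemma calibrated_euler_lagrange a U z x y : dominated S a U ->
  calibrated S a U z x -> calibrated S a U x y ->
  d2 S (z, x) + d1 S (x, y) = 0.
Proof.
rewrite /calibrated => dom zx xy; apply: (euler_lagrange S_gen) => x'.
have := dom z x'; have := dom x' y; lra.
Qed.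

(** The Euler-Lagrange equation determines each predecessor from the two following points, because
    d2 S(., x) is injective. *)
Lemma calibrated_orbits_eq a1 a2 U1 U2 xs ys :
  dominated S a1 U1 -> dominated S a2 U2 ->
  calibrated_orbit S a1 U1 xs -> calibrated_orbit S a2 U2 ys ->
  xs 0%N = ys 0%N -> xs 1%N = ys 1%N -> xs =1 ys.
Proof.
move=> dom1 dom2 cal1 cal2 e0 e1 n.
suff [] : xs n = ys n /\ xs n.+1 = ys n.+1 by [].
elim: n => // n [en enS]; split => //.
apply: (d2_inj S_gen (x := xs n.+1)) => /=.
have := calibrated_euler_lagrange dom1 (cal1 n.+1) (cal1 n).
have := calibrated_euler_lagrange dom2 (cal2 n.+1) (cal2 n).
rewrite -en -enS; lra.
Qed.

(* Aubry's lemma: two minimizing orbits issued from the same point do not cross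
   again, since exchanging their tails would strictly decrease the action. *)
Lemma calibrated_orbits_lt a1 a2 U1 U2 xs ys :
  dominated S a1 U1 -> dominated S a2 U2 ->
  calibrated_orbit S a1 U1 xs -> calibrated_orbit S a2 U2 ys ->
  xs 0%N = ys 0%N -> xs 1%N < ys 1%N -> forall n, xs n.+1 < ys n.+1.
Proof.
move=> dom1 dom2 cal1 cal2 e0 lt1; elim=> // n pq.
(* As the starting point is common, the two bounds add up to U1 p + U2 q <= U2 p + U1 q, free of
   [a1] and [a2]. *)
have := dominated_calibrated_orbit n.+1 dom2 cal1.
have := dominated_calibrated_orbit n.+1 dom1 cal2.
rewrite -e0 => D1 D2.
have := cal1 n.+1; have := cal2 n.+1; have := cal1 n.+2.
move: pq D1 D2.
set p := xs n.+1; set q := ys n.+1; set b := xs n.+2; set a := ys n.+2.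
rewrite /calibrated => pq D1 D2 calz calq calp.
have dom1q := dom1 b q; have dom2p := dom2 a p.
rewrite ltNge; apply/negP; rewrite le_eqVlt => /orP[/eqP ab|ab]; last first.
  have := twist_exchange S_gen ab pq; lra.
(* If the predecessors coincide, exchanging costs nothing and all inequalities are equalities. Then
   p and q both continue the step from [xs n.+3] to b, so Euler-Lagrange at b forces p = q. *)
have calbq : calibrated S a1 U1 b q.
  by rewrite /calibrated; move: ab calq dom2p => -> calq dom2p; lra.
have Ep := calibrated_euler_lagrange dom1 calz calp.
have Eq := calibrated_euler_lagrange dom1 calz calbq.
have : p = q by apply: (d1_inj S_gen (x := b)) => /=; lra.
lra.
Qed.

Lemma calibrated_orbits_le a1 a2 U1 U2 xs ys :
  dominated S a1 U1 -> dominated S a2 U2 ->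
  calibrated_orbit S a1 U1 xs -> calibrated_orbit S a2 U2 ys ->
  xs 0%N = ys 0%N -> xs 1%N <= ys 1%N -> forall n, xs n <= ys n.
Proof.
move=> dom1 dom2 cal1 cal2 e0; rewrite le_eqVlt => /orP[/eqP e1|lt1] n.
  by rewrite (calibrated_orbits_eq dom1 dom2 cal1 cal2).
case: n => [|n]; first by rewrite e0.
exact/ltW/(calibrated_orbits_lt dom1 dom2 cal1 cal2).
Qed.

End Crossing.

(** * Convexity of alpha and comparison of rotation numbers *)

Section RotationNumber.
Context (R : realType) (S : R * R -> R) (alpha : R -> R).
Hypothesis solvable : forall c, exists U, KAM_primitive S c (alpha c) U.
Implicit Types (c : R) (U : R -> R) (xs ys : nat -> R).

(** The Archimedean property, used to discard bounded errors along orbits. *)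
Lemma natmul_bounded_below (C v : R) :
  (forall n : nat, C <= n%:R * v) -> 0 <= v.
Proof.
move=> Cv; rewrite leNgt; apply/negP => v0.
have := Cv (Num.truncn (C / v)).+1; apply/negP; rewrite -ltNge.
by rewrite -ltr_ndivrMr// truncnS_gt.
Qed.

(** The primitives for c' and c differ by (c' - c) x up to B + B'; this error occurs at both ends of
    the orbit segment. *)
Lemma alpha_displacement c c' U xs : KAM_primitive S c (alpha c) U ->
  calibrated_orbit S (alpha c) U xs ->
  exists C, forall n,
    C + (c' - c) * (xs 0%N - xs n) <= n%:R * (alpha c' - alpha c).
Proof.
move=> [_ [B UB] _ _] cal; have [U' [_ [B' UB'] dom' _]] := solvable c'.
exists (- (2 * B + 2 * B')) => n.
apply: le_trans (dominated_calibrated_orbit n dom' cal).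
have := UB (xs 0%N); have := UB (xs n).
have := UB' (xs 0%N); have := UB' (xs n).
rewrite !ler_norml; lra.
Qed.

(** Along one calibrated orbit of class c, the weights k and h cancel the displacement terms of the
    classes c - h and c + k. *)
Lemma alpha_convex c h k : 0 < h -> 0 < k ->
  0 <= k * (alpha (c - h) - alpha c) + h * (alpha (c + k) - alpha c).
Proof.
move=> h0 k0; have [U KU] := solvable c.
have [_ _ _ calU] := KU; have [y yx] := calU 0.
have [xs [cal _ _]] := calibrated_orbit_exists calU yx.
have [C1 C1P] := alpha_displacement (c - h) KU cal.
have [C2 C2P] := alpha_displacement (c + k) KU cal.
apply: (@natmul_bounded_below (k * C1 + h * C2)) => n.
have := C1P n; rewrite -(ler_pM2l k0) => H1.
have := C2P n; rewrite -(ler_pM2l h0); lra.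
Qed.

Context (rho : R -> R).
Hypothesis rhoP : is_rotation_number alpha rho.

(** Outside [c1, c2], convexity keeps alpha above the line through the chord, so the slope [m] lies
    between the two derivatives. Only increments of the linear function matter, hence its base point
    0. *)
Lemma rotation_number_nondecreasing c1 c2 : c1 < c2 -> rho c1 <= rho c2.
Proof.
move=> c12; have d0 : 0 < c2 - c1 by rewrite subr_gt0.
pose m := (alpha c2 - alpha c1) / (c2 - c1).
have mE : (c2 - c1) * m = alpha c2 - alpha c1 by rewrite /m; field; lra.
apply: (@le_trans _ _ m).
  apply: (@is_derive_le _ ( *%R m) alpha 0 c1);
    [exact: is_derive_mull|exact: rhoP|].
  move=> h h0; have := alpha_convex c1 h0 d0.
  rewrite [c1 + (c2 - c1)]addrC subrK -mE => H.
  by rewrite -(pmulr_rge0 _ d0); lra.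
apply: (@is_derive_le _ alpha ( *%R m) c2 0);
  [exact: rhoP|exact: is_derive_mull|].
move=> h h0; have := alpha_convex c2 d0 h0.
rewrite opprB [c2 + (c1 - c2)]addrC subrK -[alpha c1 - _]opprB -mE => H.
by rewrite -(pmulr_rge0 _ d0); lra.
Qed.

(** The displacements enter with weights h and -h. Since the orbits start together, their sum is h
    (y_n - x_n) >= 0, and only bounded constants remain. *)
Lemma rotation_number_orbits_le c1 c2 U1 U2 xs ys :
  KAM_primitive S c1 (alpha c1) U1 -> KAM_primitive S c2 (alpha c2) U2 ->
  calibrated_orbit S (alpha c1) U1 xs -> calibrated_orbit S (alpha c2) U2 ys ->
  xs 0%N = ys 0%N -> (forall n, xs n <= ys n) -> rho c2 <= rho c1.
Proof.
move=> K1 K2 cal1 cal2 e0 xy.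
apply: (is_derive_le (rhoP c1) (rhoP c2)) => h h0.
have [C1 C1P] := alpha_displacement (c1 + h) K1 cal1.
have [C2 C2P] := alpha_displacement (c2 - h) K2 cal2.
apply: (@natmul_bounded_below (C1 + C2)) => n.
have := xy n; rewrite -(ler_pM2l h0).
have := C1P n; have := C2P n; rewrite e0; lra.
Qed.

End RotationNumber.

(** * Limits of derivatives and their convex hulls *)

Section Subdifferential.
Context (R : realType).
Implicit Types (a c e p q x y z : R) (u : circle R -> R).

Lemma has_deriv_lift u x p :
  has_deriv u (to_circle x) p <-> is_derive x 1 (lift_fun u) p.
Proof.
split=> [[x' /to_circle_eqP kint up]|up]; last by exists x.
suff E :
    (fun h : R => h^-1 *: ((lift_fun u \o shift x) (h *: 1) - lift_fun u x)) =
    (fun h : R => h^-1 *: ((lift_fun u \o shift x') (h *: 1) - lift_fun u x')).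
  have [du <-] := up; split; first by rewrite /derivable E.
  by rewrite /derive E.
by apply/funext => h /=; congr (_ *: (_ - _));
  rewrite -[LHS](lift_fun_periodic u _ kint); congr lift_fun; ring.
Qed.

(** Openness of [to_circle] lets adherence in the annulus be tested near a chosen lift. *)
Lemma closure_graph_derivP u x p (P : set (R * R)) :
  closure (graph_deriv u) (to_circle x, p) -> nbhs (x, p) P ->
  exists2 z, P z & is_derive z.1 1 (lift_fun u) z.2.
Proof.
move=> cl [[A B] /= [Ax Bp] ABP].
have cA : nbhs (to_circle x) (@to_circle R @` A^°).
  apply: open_nbhs_nbhs; split; first exact/to_circle_open/open_interior.
  by exists x => //; exact: nbhs_singleton (nbhs_interior Ax).
have [|[t q]/= [+ [[x' Ax' x't] Bq]]] := cl ((@to_circle R @` A^°) `*` B).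
  by exists (@to_circle R @` A^°, B).
rewrite /graph_deriv/= -x't => /has_deriv_lift du.
exists (x', q) => //; apply: ABP; split => //=; exact: interior_subset.
Qed.

(** The equation d2 S(y, x) = c + p fixes y. At nearby points x' of differentiability, minimizers y'
    satisfy d2 S(y', x') = c + p', so they are close to y, and calibration passes to the limit. *)
Lemma closure_graph_deriv_calibrated F S c a u x p :
  generating_function F S ->
  KAM_primitive S c a (fun x => lift_fun u x + c * x) ->
  closure (graph_deriv u) (to_circle x, p) ->
  exists2 y, calibrated S a (fun x => lift_fun u x + c * x) y x &
    d2 S (y, x) = c + p.
Proof.
set U := (fun x => _) => S_gen [Uc _ dom cal] cl.
have [y yP] := d2_surjective S_gen x (c + p).
exists y => //; apply/eqP; rewrite eq_le dom/=; apply/ler_addgt0Pr => e e0.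
(* [G] is the calibration defect: nonnegative by domination, zero exactly at calibrated pairs. *)
pose G (z : R * R) := U z.1 + S z + a - U z.2.
have Gc : continuous G.
  move=> z; apply: cvgB; last first.
    by apply: (@continuous_comp _ _ _ snd U); [exact: cvg_snd|exact: Uc].
  apply: cvgD; last exact: cvg_cst.
  apply: cvgD; last exact: (generating_continuous S_gen).
  by apply: (@continuous_comp _ _ _ fst U); [exact: cvg_fst|exact: Uc].
have : \forall z \near (y, x), G (y, x) - e < G z.
  by move/cvgr_gt: (Gc (y, x)); apply; lra.
move=> /nbhs_ballP[d/= d0 dP]; have d20 : 0 < d / 2 by rewrite divr_gt0.
have dc (b : R) : continuous (fun z : R * R => d2 S (b, z.1) - z.2).
  move=> z; apply: cvgB; last exact: cvg_snd.
  apply: (@continuous_comp _ _ _ (fun z : R * R => (b, z.1)) (d2 S)).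
    apply: (@cvg_pair _ _ _ (nbhs z) (nbhs b) (nbhs z.1) _ _ _ (fun=> b) fst);
      [exact: cvg_cst|exact: cvg_fst].
  exact: (d2_continuous S_gen).
(* Strict inequalities at (x, p) persist nearby; by monotonicity of d2 S(., x') they will trap y'
   within d / 2 of y. *)
have near_l : \forall z \near (x, p), c < d2 S (y - d / 2, z.1) - z.2.
  move/cvgr_gt: (dc (y - d / 2) (x, p)); apply => /=.
  have : d2 S (y, x) < d2 S (y - d / 2, x) by apply: (d2_decreasing S_gen); lra.
  lra.
have near_r : \forall z \near (x, p), d2 S (y + d / 2, z.1) - z.2 < c.
  move/cvgr_lt: (dc (y + d / 2) (x, p)); apply => /=.
  have : d2 S (y + d / 2, x) < d2 S (y, x) by apply: (d2_decreasing S_gen); lra.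
  lra.
have near_x : \forall z \near (x, p), `|x - z.1| < d.
  have /cvgrPdist_lt : (fun z : R * R => z.1) @ (x, p) --> x by exact: cvg_fst.
  exact.
have [[x' p']/= [[ly ry] dx] du] := closure_graph_derivP cl
  (filterI (filterI near_l near_r) near_x).
have [y' y'P] := cal x'.
(* By domination, x' minimizes S(y', z) - U z over z, and this function is differentiable at x'. *)
have dS : d2 S (y', x') - (p' + c) = 0.
  apply: (@is_derive_global_min _
    ((fun z => S (y', z)) - (lift_fun u + *%R c)) x').
    have := is_deriveD du (is_derive_mull c x').
    exact: is_deriveB (is_derive_d2 S_gen y' x').
  move=> z; rewrite !fctE; have := dom y' z.
  move: y'P; rewrite /calibrated /U; lra.
have y'l : y - d / 2 < y'.
  rewrite ltNge le_eqVlt; apply/negP => /orP[/eqP E|].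
    by move: dS ly; rewrite E; lra.
  by move=> /(d2_decreasing S_gen x') /=; lra.
have y'r : y' < y + d / 2.
  rewrite ltNge le_eqVlt; apply/negP => /orP[/eqP E|].
    by move: dS ry; rewrite E; lra.
  by move=> /(d2_decreasing S_gen x') /=; lra.
have := dP (y', x'); rewrite /G/= => H.
have : U y + S (y, x) + a - U x - e < U y' + S (y', x') + a - U x'.
  apply: H; split => //=.
  by rewrite /ball/= ltr_norml; lra.
move: y'P; rewrite /calibrated; lra.
Qed.

Lemma convR_lt (p q m : R) (l : {i01 R}) :
  p < m -> q < m -> l%:num * p + (1 - l%:num) * q < m.
Proof.
rewrite -!(subr_gt0 _ m) => pm qm; have := convR_gt0 l pm qm.
by rewrite convRE /unstable.onem; lra.
Qed.

Lemma convR_gt (p q m : R) (l : {i01 R}) :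
  m < p -> m < q -> m < l%:num * p + (1 - l%:num) * q.
Proof.
rewrite -!(subr_gt0 m) => pm qm; have := convR_gt0 l pm qm.
by rewrite convRE /unstable.onem; lra.
Qed.

(** Open half-lines are convex, so strict bounds survive the hull. *)
Lemma convex_hull_lt (E : set R) m : E `<=` [set p | p < m] ->
  smallest (@convex_set R R^o) E `<=` [set p | p < m].
Proof. by apply: smallest_sub => p q l; rewrite !inE; exact: convR_lt. Qed.

Lemma convex_hull_gt (E : set R) m : E `<=` [set p | m < p] ->
  smallest (@convex_set R R^o) E `<=` [set p | m < p].
Proof. by apply: smallest_sub => p q l; rewrite !inE; exact: convR_gt. Qed.

End Subdifferential.

(** * Strict ordering of the two solutions *)

Theorem proposition2p3 (R : realType)
  (f : annulus R -> annulus R) (f_twist : symplectic_twist_map f)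
  (F : R * R -> R * R) (F_lift : is_lift f F)
  (S : R * R -> R) (S_gen : generating_function F S)
  (alpha : R -> R) (alphaP : is_alpha S alpha)
  (rho : R -> R) (rhoP : is_rotation_number alpha rho)
  (c1 c2 : R) (u1 u2 : circle R -> R)
  (u1_KAM : weak_KAM S alpha c1 u1) (u2_KAM : weak_KAM S alpha c2 u2)
  (rho_lt : rho c1 < rho c2) :
  [/\ c1 < c2,
      (forall (t : circle R) (p1 p2 : R),
         gen_subdiff u1 t (t, p1) -> gen_subdiff u2 t (t, p2) ->
         c1 + p1 < c2 + p2) &
      (forall (t : circle R) (p1 p2 : R),
         has_deriv u1 t p1 -> has_deriv u2 t p2 -> c1 + p1 < c2 + p2)].
Proof.
have solvable c : exists U, KAM_primitive S c (alpha c) U.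
  have [/(_ erefl)[u uP] _] := alphaP c (alpha c).
  by eexists; exact: weak_KAM_primitive S_gen uP.
have K1 := weak_KAM_primitive S_gen u1_KAM.
have K2 := weak_KAM_primitive S_gen u2_KAM.
have lt_closure t p1 p2 : closure (graph_deriv u1) (t, p1) ->
    closure (graph_deriv u2) (t, p2) -> c1 + p1 < c2 + p2.
  have [x <-] := to_circle_surj t.
  move=> /(closure_graph_deriv_calibrated S_gen K1)[x1 cal1 <-].
  move=> /(closure_graph_deriv_calibrated S_gen K2)[y1 cal2 <-].
  (* The order reverses: it remains to exclude x1 <= y1 for the two minimizers at x. *)
  apply: (d2_decreasing S_gen); rewrite ltNge; apply/negP => xy.
  have [_ _ dom1 /calibrated_orbit_exists/(_ cal1)[xs [xscal xs0 xs1]]] := K1.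
  have [_ _ dom2 /calibrated_orbit_exists/(_ cal2)[ys [yscal ys0 ys1]]] := K2.
  have e0 : xs 0%N = ys 0%N by rewrite xs0 ys0.
  have := calibrated_orbits_le S_gen dom1 dom2 xscal yscal e0.
  rewrite xs1 ys1 => /(_ xy).
  move=> /(rotation_number_orbits_le solvable rhoP K1 K2 xscal yscal e0).
  by rewrite leNgt rho_lt.
split.
- rewrite ltNge le_eqVlt; apply/negP => /orP[/eqP c12|].
    by move: rho_lt; rewrite c12 ltxx.
  by move=> /(rotation_number_nondecreasing solvable rhoP); rewrite leNgt rho_lt.
- move=> t p1 p2 [_ /= H1] [_ /= H2].
  (* The hulls are treated one at a time: first p1 against a fixed limit slope q of u2, then p2. *)
  have lt2 q : closure (graph_deriv u2) (t, q) -> c1 + p1 < c2 + q.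
    move=> q2; have : p1 < c2 + q - c1; last by lra.
    by apply: convex_hull_lt H1 => p /= /lt_closure/(_ q2); lra.
  have : c1 + p1 - c2 < p2; last by lra.
  by apply: convex_hull_gt H2 => q /= /lt2; lra.
move=> t p1 p2 d1 d2.
by apply: (lt_closure t); apply: subset_closure.
Qed.
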